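(* Let $G$ be a simple connected quartic ($4$-regular) graph with the triangle property on at least $5$ vertices. Then either: (1) $G$ is (isomorphic to) the squared cycle $C_n^2$ for some $n\ge 5$; or (2) $G$ is obtained from the line multigraph $L(M)$ of a cubic multigraph $M$ by repeatedly (zero or more times) replacing triangles by copies of $K_{1,1,3}$, in such a way that all multiple edges are eliminated.
   Context: Multigraphs are finite and loopless; parallel edges are allowed, and edges count with multiplicity towards degrees. Cubic means $3$-regular. A triangle is a set of three edges pairwise joining three distinct vertices. A multigraph has the triangle property if every edge lies in a triangle. Squared cycle: for $n\ge5$, $C_n^2$ is the simple graph on $\mathbb{Z}_n$ in which $i$ is adjacent to $i\pm1$ and $i\pm 2$. Line multigraph: $L(M)$ has the edges of $M$ as its vertices, and two distinct edges of $M$ are joined by $k$ edges in $L(M)$ if they are mutually incident to exactly $k$ vertices of $M$. Replacing a triangle by a copy of $K_{1,1,3}$ (called Operation 2) means: choose an eligible triangle $\{xy,yz,zx\}$ of the current multigraph, delete these three edges (keeping all vertices and all other edges), add two new vertices $u,v$, and add the edges $ux,uy,uz,vx,vy,vz,uv$. Here a triangle $T$ (a set of three edges) is eligible if deleting its three edges does not destroy the triangle property, or if one of its three edges belongs to a triple edge. *)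

(* Defs.v *)
From mathcomp Require Import all_boot all_algebra.
Set Implicit Arguments.
Unset Strict Implicit.
Unset Printing Implicit Defensive.

(* Finite loopless multigraphs: edges are objects of their own, so parallel
   edges are distinct edges with the same pair of ends. *)
Record mgraph := MGraph {
  vert : finType;
  edge : finType;
  ends : edge -> {set vert};
  card_ends : forall e, #|ends e| = 2 }.

Definition isomorphic (G H : mgraph) : Prop :=
  exists (f : vert G -> vert H) (g : edge G -> edge H),
    [/\ bijective f, bijective g & forall e, ends (g e) = f @: ends e].

Definition simple_graph (G : mgraph) : Prop := injective (@ends G).

Definition degree (G : mgraph) (x : vert G) : nat :=
  #|[set e : edge G | x \in ends e]|.

Definition regular (k : nat) (G : mgraph) : Prop :=
  forall x : vert G, degree x = k.

Definition adjacent (G : mgraph) : rel (vert G) :=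
  fun x y => [exists e : edge G, ends e == [set x; y]].

Definition connected_graph (G : mgraph) : Prop :=
  forall x y : vert G, connect (@adjacent G) x y.

Definition triangle (G : mgraph) (T : {set edge G}) : Prop :=
  exists (x y z : vert G) (a b c : edge G),
    [/\ uniq [:: x; y; z],
        [/\ ends a = [set x; y], ends b = [set y; z] & ends c = [set z; x]]
      & T = [set a; b; c]].

Definition triangle_property (G : mgraph) : Prop :=
  forall e : edge G, exists2 T : {set edge G}, triangle T & e \in T.

Section SimpleGraphOfRelation.

Variables (V : finType) (r : rel V).

(* Edges are the 2-subsets of V whose elements are related (in both
   directions); loops of r are ignored. *)
Definition rel_edge (A : {set V}) : bool :=
  (#|A| == 2) && [forall x in A, forall y in A, (x != y) ==> r x y].

Lemma card_rel_ends (e : {A : {set V} | rel_edge A}) : #|val e| = 2.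
Proof. by case/andP: (valP e) => /eqP. Qed.

Definition graph_of_rel : mgraph :=
  @MGraph V {A : {set V} | rel_edge A} val card_rel_ends.

End SimpleGraphOfRelation.

(* Only meaningful as C_n^2 for n >= 5; 'Z_n is the ring Z/nZ for n >= 2. *)
Definition squared_cycle (n : nat) : mgraph :=
  graph_of_rel (fun i j : 'Z_n =>
    j \in [:: i + 1; i - 1; i + 2; i - 2]%R).

Section LineMultigraph.

Variable M : mgraph.

(* An edge of L(M) is a pair ({e, f}, v) with e, f distinct edges of M and v a
   vertex incident to both, so that e and f are joined by as many edges as they
   have common vertices. *)
Definition line_edge (p : {set edge M} * vert M) : bool :=
  (#|p.1| == 2) && [forall e in p.1, p.2 \in ends e].

Lemma card_line_ends (p : {p | line_edge p}) : #|(val p).1| = 2.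
Proof. by case/andP: (valP p) => /eqP. Qed.

Definition line_mgraph : mgraph :=
  @MGraph (edge M) {p | line_edge p} (fun p => (val p).1) card_line_ends.

End LineMultigraph.

Section Operations.

Variables (G : mgraph) (T : {set edge G}).

Definition delete_edges : mgraph :=
  @MGraph (vert G) {e : edge G | e \notin T} (fun e => ends (val e))
    (fun e => card_ends (val e)).

Definition multiplicity (e : edge G) : nat :=
  #|[set f : edge G | ends f == ends e]|.

Definition eligible : Prop :=
  triangle T /\
  (triangle_property delete_edges \/ exists2 e, e \in T & multiplicity e = 3).

Definition corners : {set vert G} := \bigcup_(e in T) ends e.

(* The two new vertices are inr true and inr false; besides the surviving edges
   of G, there is an edge (b, x) from inr b to each corner x of T, and one edge
   (tt) joining the two new vertices. *)
Definition op2_edge : finType :=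
  (edge delete_edges + (bool * {x : vert G | x \in corners}) + unit)%type.

Definition op2_ends (e : op2_edge) : {set vert G + bool} :=
  match e with
  | inl (inl e0) => inl @: ends e0
  | inl (inr (b, x)) => [set inr b; inl (val x)]
  | inr tt => [set inr true; inr false]
  end.

Lemma card_op2_ends (e : op2_edge) : #|op2_ends e| = 2.
Proof.
case: e => [[e|[b x]]|[]] /=; rewrite ?cards2 //.
by rewrite card_imset ?card_ends // => x y [].
Qed.

Definition op2 : mgraph :=
  @MGraph (vert G + bool)%type op2_edge op2_ends card_op2_ends.

End Operations.

Inductive op2_reachable (G : mgraph) : mgraph -> Prop :=
| op2_refl : op2_reachable G G
| op2_step (H : mgraph) (T : {set edge H}) :
    op2_reachable G H -> eligible T -> op2_reachable G (op2 T).

(* Main.v *)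
Require Import Defs.
From mathcomp Require Import all_boot all_algebra ring.
From Stdlib Require Import Classical_Prop.
Set Implicit Arguments.
Unset Strict Implicit.
Unset Printing Implicit Defensive.

(* If some vertex has a neighbourhood inducing a path a-b-c-d whose middle edge
   bc lies in a single triangle, then this local picture propagates along the
   graph and forces a squared cycle. K_5 and the octahedron
   are squared cycles as well. In all other cases the edges of G are partitioned
   into triangles and copies of K_{1,1,3}: the latter are the closed
   neighbourhoods of pairs of adjacent twins (one pair being selected in each K4
   containing two), the former are the triangles that avoid the selected twins
   and have an edge lying in no other triangle. The multigraph M whose vertices are
   the parts and whose edges are the vertices of G other than selected twins is
   cubic, and replacing the triangles of L(M) that stand for copies of K_{1,1,3}
   one at a time yields G. Every such step is legal: all the other parts remain
   triangles or copies of K_{1,1,3}, so no edge outside the replaced triangle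
   loses the triangle property. *)

Ltac split_hyps := repeat (match goal with
  | H : is_true (uniq (_ :: _)) |- _ =>
      move: H; rewrite /= => H
  | H : is_true (_ \notin _ :: _) |- _ => move: H; rewrite inE ?negb_or => H
  | H : is_true (all _ (_ :: _)) |- _ => move: H; rewrite /= => H
  | H : is_true (_ && _) |- _ =>
      let H1 := fresh "H" in let H2 := fresh "H" in case/andP: H => H1 H2
  end).

Ltac neq_bool :=
  rewrite /= ?inE ?negb_or;
  repeat (apply/andP; split);
  try solve [ done | assumption | by rewrite eq_sym ].

(** * Cyclic sequences and decompositions as combinatorial data *)

(** Only the edges from each index to the next two, modulo [n], are demanded; in a connected quartic
    graph they already exhaust the degrees, so the sequence covers the whole graph. *)
Definition square_cyclic (V : finType) (r : rel V) (n : nat) (v : nat -> V) :=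
  [/\ 4 < n, forall i j, i < n -> j < n -> v i = v j -> i = j &
      forall i, i < n -> r (v i) (v (i.+1 %% n)) /\ r (v i) (v (i.+2 %% n))].

(* A part is the vertex set of a triangle, with empty centre, or of a copy of
   K_{1,1,3}, whose centre consists of its two adjacent vertices of degree 4. *)
Definition part_edge (V : finType) (centre : {set V} -> {set V}) (p : {set V}) (x y : V) :=
  [&& x != y, x \in p, y \in p & [|| centre p == set0, x \in centre p | y \in centre p]].

(** The fields [part_adj], [part_exists] and [part_unique] make the part edges a partition of the
    edges of [r]; [centre_part] keeps a centre vertex inside a single part. *)
Record decomposition (V : finType) (r : rel V) (F : {set {set V}})
    (centre : {set V} -> {set V}) : Prop := Decomposition {
  centre_sub : forall p, centre p \subset p;
  card_corners : forall p, p \in F -> #|p :\: centre p| = 3;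
  card_centre : forall p, p \in F -> centre p = set0 \/ #|centre p| = 2;
  part_adj : forall p x y, p \in F -> part_edge centre p x y -> r x y;
  part_exists : forall x y, r x y -> exists2 p, p \in F & part_edge centre p x y;
  part_unique : forall p q x y, p \in F -> q \in F ->
    part_edge centre p x y -> part_edge centre q x y -> p = q;
  centre_part : forall p q x, p \in F -> q \in F ->
    x \in centre p -> x \in q -> q = p }.

Lemma card_set3 (T : finType) (a b c : T) : uniq [:: a; b; c] -> #|[set a; b; c]| = 3.
Proof.
move/card_uniqP => /= <-; rewrite -cardsE; apply: eq_card => x.
by rewrite !inE orbA.
Qed.

(** * The local structure of quartic graphs with the triangle property *)

Section Quartic.

Variables (V : finType) (r : rel V).
Hypotheses (rsym : symmetric r) (rirr : irreflexive r).
Hypothesis deg4 : forall x, #|[set y | r x y]| = 4.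
Hypothesis tri : forall x y, r x y -> exists2 z, r x z & r y z.

Ltac adj := first
  [ assumption | by rewrite rsym | by split_hyps; neq_bool ].

Lemma adj_neq x y : r x y -> x != y.
Proof. by apply: contraTneq => ->; rewrite rirr. Qed.

(** Degree 4 in usable form: adjacency to [x] becomes membership in an explicit list of four
    vertices, on which the later case analyses run. *)
Lemma nbr_complete x s : uniq s -> all (r x) s ->
  exists s', [/\ size (s ++ s') = 4, uniq (s ++ s') &
                 forall y, r x y = (y \in s ++ s')].
Proof.
move=> us /allP xs.
exists (enum [set y | r x y & y \notin s]).
have E y : r x y = (y \in s ++ enum [set y | r x y & y \notin s]).
  rewrite mem_cat mem_enum inE; case: (boolP (y \in s)) => [/xs -> //|].
  by rewrite andbT.
have U : uniq (s ++ enum [set y | r x y & y \notin s]).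
  rewrite cat_uniq us enum_uniq andbT /=; apply/hasPn => y.
  by rewrite mem_enum inE => /andP[].
split=> //; rewrite -(deg4 x) -(card_uniqP U); apply: eq_card => y.
by rewrite inE E.
Qed.

Lemma nbr4 x a b c d : uniq [:: a; b; c; d] ->
  r x a -> r x b -> r x c -> r x d ->
  forall y, r x y = (y \in [:: a; b; c; d]).
Proof.
move=> us xa xb xc xd y.
have xs : all (r x) [:: a; b; c; d] by rewrite /= xa xb xc xd.
by have [[|? ?] [// _ _ ->]] := nbr_complete us xs.
Qed.

Lemma nbr3 x a b c : uniq [:: a; b; c] -> r x a -> r x b -> r x c ->
  exists d, [/\ r x d, uniq [:: a; b; c; d] &
                forall y, r x y = (y \in [:: a; b; c; d])].
Proof.
move=> us xa xb xc.
have xs : all (r x) [:: a; b; c] by rewrite /= xa xb xc.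
have [[|d[|? ?]] [// _ u E]] := nbr_complete us xs.
by exists d; split=> //; rewrite E !inE eqxx !orbT.
Qed.

Lemma nbr2 x a b : uniq [:: a; b] -> r x a -> r x b ->
  exists c d, [/\ r x c, r x d, uniq [:: a; b; c; d] &
                forall y, r x y = (y \in [:: a; b; c; d])].
Proof.
move=> us xa xb.
have xs : all (r x) [:: a; b] by rewrite /= xa xb.
have [[|c[|d[|? ?]]] [// _ u E]] := nbr_complete us xs.
by exists c, d; split=> //; rewrite E !inE eqxx !orbT.
Qed.

(* In a squared cycle [a, b, x, c, d] are consecutive vertices. *)
Definition window a b x c d :=
  [&& uniq [:: a; b; x; c; d], all (r x) [:: a; b; c; d],
      [&& r a b, r b c & r c d], [&& ~~ r a c, ~~ r b d & ~~ r a d]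
    & [forall z, r b z && r c z ==> (z == x)]].

(** * Windows: propagation and closing up *)

Lemma window_nbr a b x c d : window a b x c d ->
  forall y, r x y = (y \in [:: a; b; c; d]).
Proof.
case/and5P => /= u /and5P[xa xb xc xd _] _ _ _; apply: nbr4 => //.
by split_hyps; neq_bool.
Qed.

(** The new vertex [e] is the fourth neighbour of [c]. The edge [ce] needs a triangle, and neither
    [b] nor [x] is adjacent to [e], so [d] is. The only common neighbour of [x] and [d] is [c], so
    the new middle edge again lies in a single triangle. *)
Lemma window_next a b x c d : window a b x c d -> exists e, window b x c d e.
Proof.
move=> W; have Nx := window_nbr W; case/and5P: W => /= u.
case/and5P=> [xa xb xc xd _] /and3P[ab bc cd] /and3P[ac bd ad] /forallP bcx.
have {}bcx z : r b z -> r c z -> z = x.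
  by move=> bz cz; have := bcx z; rewrite bz cz => /eqP.
have cb : r c b by rewrite rsym.
have cx : r c x by rewrite rsym.
have bx : r b x by rewrite rsym.
move: (u); rewrite !inE !negb_or -!andbA.
case/and5P=> a_b a_x a_c a_d /and5P[b_x b_c b_d x_c /and3P[x_d c_d _]].
have [|e [ce ue Nc]] := @nbr3 c b x d _ cb cx cd.
  by rewrite /= !inE !negb_or b_x b_d x_d.
have Nc' := Nc; move: ue; rewrite /= !inE !negb_or -!andbA.
case/and5P=> _ _ be _ /and3P[xe de _].
have nbe : ~~ r b e by apply/negP => h; rewrite (bcx e h ce) eqxx in xe.
have nxe : ~~ r x e.
  rewrite Nx !inE !negb_or [e == b]eq_sym be [e == d]eq_sym de.
  rewrite [e == c]eq_sym (adj_neq ce) /= !andbT.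
  by apply/eqP => E; rewrite -E rsym ce in ac.
have re : r d e.
  have [w] := tri ce; rewrite Nc !inE => /or4P[] /eqP ->; rewrite rsym ?rirr //.
  + by rewrite (negPf nbe).
  + by rewrite (negPf nxe).
exists e; apply/and5P; split.
- by rewrite /= !inE !negb_or b_x b_c b_d be x_c x_d xe c_d (adj_neq ce) de.
- by rewrite /= cb cx cd ce.
- by rewrite bx xd re.
- by rewrite bd nxe nbe.
apply/forallP => z; apply/implyP => /andP[]; rewrite Nx !inE.
by case/or4P => /eqP -> //; rewrite ?rirr // rsym ?(negPf ad) ?(negPf bd).
Qed.

(** The neighbourhood of [x] induces a path, whose inner vertices do not depend on the labelling:
    were [c] an end of the second path, its two neighbours [b] and [d] on the first would
    coincide. *)
Lemma window_inner a b x c d a' b' c' d' :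
  window a b x c d -> window a' b' x c' d' -> c = b' \/ c = c'.
Proof.
move=> W W'; have Nx := window_nbr W'.
have xb : r x b by rewrite (window_nbr W) !inE eqxx !orbT.
have xc : r x c by rewrite (window_nbr W) !inE eqxx !orbT.
have xd : r x d by rewrite (window_nbr W) !inE eqxx !orbT.
case/and5P: W => u _ /and3P[_ bc cd] _ _.
case/and5P: W' => u' _ /and3P[ab' bc' cd'] /and3P[ac' bd' ad'] _.
have b_d : b != d by split_hyps.
rewrite rsym in bc; move: xb xd bc cd b_d.
have end1 e : r x e -> r a' e -> e = b'.
  rewrite Nx !inE => /or4P[] /eqP -> //; first by rewrite rirr.
    by rewrite (negPf ac').
  by rewrite (negPf ad').
have end4 e : r x e -> r d' e -> e = c'.
  rewrite Nx !inE => /or4P[] /eqP -> //; rewrite ?rirr // rsym.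
    by rewrite (negPf ad').
  by rewrite (negPf bd').
have := xc; rewrite Nx !inE => /or4P[] /eqP -> xb xd bc cd /eqP; auto.
  by rewrite (end1 _ xb bc) (end1 _ xd cd).
by rewrite (end4 _ xb bc) (end4 _ xd cd).
Qed.

(** Moving the window forward gives an infinite walk, which must repeat in a finite graph; a
    repetition with no shorter one inside closes it up. *)
Lemma window_square_cycle a b x c d : window a b x c d ->
  exists n v, square_cyclic r n v.
Proof.
move=> W0.
pose S := (V * V * V * V * V)%type.
pose ok (s : S) := let: (a, b, x, c, d) := s in window a b x c d.
(* The default [d] is never taken on a window, by [window_next]. *)
pose nxt (s : S) : S := let: (a, b, x, c, d) := s in
  (b, x, c, d, odflt d [pick e | window b x c d e]).
have nxt_ok s : ok s -> ok (nxt s).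
  case: s => [[[[a1 b1] x1] c1] d1] /= W; case: pickP => [e //|none].
  by have [e] := window_next W; rewrite none.
pose s0 : S := (a, b, x, c, d).
pose v i := (iter i nxt s0).1.1.1.1.
have ok_i i : ok (iter i nxt s0).
  by elim: i => [|i IH] //=; apply: nxt_ok.
have W i : window (v i) (v i.+1) (v i.+2) (v i.+3) (v i.+4).
  have := ok_i i; rewrite /v !iterS.
  by case: (iter i nxt s0) => [[[[a1 b1] x1] c1] d1].
have gap i j : v i = v j -> i < j -> i + 4 < j.
  move=> E ij; have := W i; case/and5P; rewrite /= !inE !negb_or -!andbA.
  case/and5P => d1 d2 d3 d4 _ _ _ _ _.
  rewrite ltnNge; apply/negP => h.
  have : j \in [:: i.+1; i.+2; i.+3; i.+4].
    have [k k4 ->] : exists2 k, k < 4 & j = i.+1 + k.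
      by exists (j - i.+1); rewrite ?subnKC // ltn_subLR // addSn ltnS.
    by case: k k4 => [|[|[|[|k]]]] // _; rewrite ?addnS addn0 !inE eqxx ?orbT.
  by rewrite !inE => /or4P[] /eqP Ej; move: d1 d2 d3 d4; rewrite E Ej eqxx.
(* Pigeonhole on [#|V| + 1] indices. The shift by 2 makes the repeated vertex the centre of the
   windows that start at [i] and [i + n]. *)
have rep : exists i n, 0 < n /\ v i.+2 = v (i.+2 + n).
  have : ~~ injectiveb (fun i : 'I_(#|V|.+1) => v i.+2).
    apply/negP => /injectiveP inj.
    have := max_card (mem (codom (fun i : 'I_(#|V|.+1) => v i.+2))).
    by rewrite card_codom // card_ord ltnn.
  move/injectivePn => [i [j ij E]].
  wlog lt_ij : i j ij E / i < j.
    move=> IH; case: (ltngtP i j) => [|h|h]; first exact: IH.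
      by apply: (IH j i) => //; rewrite eq_sym.
    by rewrite (val_inj h) eqxx in ij.
  exists i, (j - i); rewrite subn_gt0; split=> //.
  by rewrite !addSn subnKC ?E // ltnW.
(* Shrink the gap [n] of a repetition until [v] is injective on the period. *)
case: rep => i [n]; elim/ltn_ind: n i => n IH i [n_gt0 E].
have n4 : 4 < n.
  by have := gap i.+2 (i.+2 + n) E; rewrite -{1}[i.+2]addn0 !ltn_add2l; apply.
have Wi := W i.
have Wn : window (v (i + n)) (v (i + n).+1) (v i.+2) (v (i + n).+3) (v (i + n).+4).
  by rewrite E !addSn; apply: W.
case/boolP: [exists p : 'I_n * 'I_n, (p.1 < p.2) && (v (i.+2 + p.1) == v (i.+2 + p.2))].
  case/existsP => -[j k] /= /andP[jk /eqP Ejk].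
  apply: (IH (k - j) _ (i + j)); first by rewrite ltn_subLR ?ltn_addl // ltnW.
  by rewrite subn_gt0 jk -!addSn -addnA subnKC // ltnW.
move/existsPn => inj.
have {}inj j k : j < n -> k < n -> v (i.+2 + j) = v (i.+2 + k) -> j = k.
  move=> jn kn Ejk; wlog jk : j k jn kn Ejk / j < k.
    by move=> H; case: (ltngtP j k) => // h; [|apply/esym]; exact: H.
  by have := inj (Ordinal jn, Ordinal kn); rewrite /= jk Ejk eqxx.
(* Both windows have the repeated vertex as centre, so [window_inner] applies; its other outcome
   would repeat a vertex at positions 1 and [n - 1] of the period, which differ as [n > 4]. *)
have En : v i.+3 = v (i + n).+3.
  case: (window_inner Wi Wn) => // E'.
  have := @inj 1 n.-1; rewrite addn1 E' -subn1 addnBA // !addSn subn1.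
  by move=> /(_ _ _ erefl); case: n n4 {E Wn E' IH inj n_gt0} => [|[|[|n]]] //= _ H; exfalso; have := H isT (leqnn _).
exists n, (fun j => v (i.+2 + j)); split=> // j jn.
have := W (i + j); case/and5P => _ /and5P[_ _ x1 x2 _] _ _ _.
(* Indices up to [n + 1] occur, hence two wrapped cases: [n] is settled by [E], [n + 1] by [En]. *)
have mod_v k : k < n.+2 -> v (i.+2 + k %% n) = v (i + k).+2.
  rewrite ltnS leq_eqVlt ltnS leq_eqVlt => /or3P[/eqP->|/eqP->|kn].
  - by rewrite -{1}(addn1 n) modnDl modn_small ?(leq_trans _ n4) // addn1 addnS -En.
  - by rewrite modnn addn0 E.
  - by rewrite modn_small.
by rewrite !mod_v ?ltnS ?(ltnW jn) // !addnS.
Qed.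

(** Reduces a cyclic order given as a list to a finite check; it serves for K_5 and the
    octahedron. *)
Lemma square_cyclic_seq x0 s : 4 < size s -> uniq s ->
  all (fun i => r (nth x0 s i) (nth x0 s (i.+1 %% size s)) &&
                r (nth x0 s i) (nth x0 s (i.+2 %% size s))) (iota 0 (size s)) ->
  square_cyclic r (size s) (nth x0 s).
Proof.
move=> s4 us /allP rs; split=> // [i j si sj /eqP | i si].
  by rewrite nth_uniq // => /eqP.
by apply/andP/rs; rewrite mem_iota.
Qed.

(** * Adjacent twins and the selection of twin pairs *)

Definition cnbr x := [set y | (y == x) || r x y].

Definition twin u v := (u != v) && (cnbr u == cnbr v).

Definition has_twin u := [exists v, twin u v].

Lemma in_cnbr x y : (y \in cnbr x) = (y == x) || r x y.
Proof. by rewrite inE. Qed.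

Lemma mem_cnbr x : x \in cnbr x.
Proof. by rewrite in_cnbr eqxx. Qed.

Lemma card_cnbr x : #|cnbr x| = 5.
Proof.
have -> : cnbr x = x |: [set y | r x y] by apply/setP => y; rewrite !inE.
by rewrite cardsU1 deg4 inE rirr.
Qed.

Lemma cnbr_sym x y : (y \in cnbr x) = (x \in cnbr y).
Proof. by rewrite !in_cnbr eq_sym rsym. Qed.

Lemma twin_sym u v : twin u v = twin v u.
Proof. by rewrite /twin eq_sym [cnbr u == _]eq_sym. Qed.

Lemma twin_adj u v : twin u v -> r u v.
Proof.
case/andP => uv /eqP E; have := mem_cnbr v; rewrite -E in_cnbr eq_sym.
by rewrite (negPf uv).
Qed.

Lemma twin_nbr u v x : twin u v -> x != v -> r u x -> r v x.
Proof.
case/andP => _ /eqP E xv ux.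
by have : x \in cnbr v; [rewrite -E in_cnbr ux orbT | rewrite in_cnbr (negPf xv)].
Qed.

Hypothesis not_square : forall n v, ~ square_cyclic r n v.

(** If the fourth neighbour [w] of [y] is [z], the five vertices form K_5, which is C_5^2. Otherwise
    [yw] lies in no triangle, since [u], [v] and [x] have all their neighbours among the five
    vertices. *)
Lemma twin_corner_adj2 u v x y z : uniq [:: u; v; x; y; z] -> twin u v ->
  r u x -> r u y -> r u z -> r x y -> r x z -> False.
Proof.
move=> us tw ux uy uz xy xz.
have uv := twin_adj tw.
have [vx vy vz] : [/\ r v x, r v y & r v z].
  split; apply: twin_nbr tw _ _ => //; split_hyps; neq_bool.
have Nu : forall w, r u w = (w \in [:: v; x; y; z]).
  by apply: nbr4; adj.
have Nv : forall w, r v w = (w \in [:: u; x; y; z]).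
  by apply: nbr4; adj.
have Nx : forall w, r x w = (w \in [:: u; v; y; z]).
  by apply: nbr4; adj.
have [||||w [yw uw Ny]] := @nbr3 y u v x; try adj.
have [Ew|w_z] := eqVneq w z.
  rewrite Ew in yw.
  apply: (@not_square 5 _ (@square_cyclic_seq u [:: u; v; x; y; z] _ _ _)) => //=.
  by rewrite uv ux vx vy xy xz yw ![r _ u]rsym uy uz ![r _ v]rsym vz.
have [q yq wq] := tri yw.
have w_y := adj_neq yw.
move: yq wq; rewrite Ny !inE => /or4P[] /eqP ->; rewrite ?rirr // rsym ?(Nu, Nv, Nx) => H;
 apply/negP: H; split_hyps; neq_bool.
Qed.

(** Two twins [v], [w] of [u] would make [w] a corner adjacent to both other corners of the pair
    [u], [v]. *)
Lemma twin_unique u v w : twin u v -> twin u w -> v = w.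
Proof.
move=> tv tw; apply/eqP/negPn/negP => v_w.
have uv := twin_adj tv; have uw := twin_adj tw.
have [|||y [z [uy uz us _]]] := @nbr2 u v w; try adj.
have u_v := adj_neq uv; have u_w := adj_neq uw.
have u_y := adj_neq uy; have u_z := adj_neq uz.
apply: (@twin_corner_adj2 u v w y z) => //; first adj.
  by apply: twin_nbr tw _ uy; adj.
by apply: twin_nbr tw _ uz; adj.
Qed.


(** The fourth neighbour [a] of [x] is not the third corner [z], by [twin_corner_adj2], so it is
    adjacent to neither [u] nor [v]. The triangle on [xa] must then go through [y], and [x] and [y]
    have the same closed neighbourhood. *)
Lemma adj_corners_twin u v x y : twin u v -> x != v -> y != v ->
  r u x -> r u y -> r x y -> twin x y.
Proof.
move=> tw x_v y_v ux uy xy.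
have uv := twin_adj tw.
have u_v := adj_neq uv; have u_x := adj_neq ux; have u_y := adj_neq uy.
have x_y := adj_neq xy.
have vx := twin_nbr tw x_v ux; have vy := twin_nbr tw y_v uy.
have [||||z [uz us Nu]] := @nbr3 u v x y; try adj.
have vz : r v z by apply: twin_nbr tw _ uz; adj.
have Nv : forall w, r v w = (w \in [:: u; x; y; z]).
  have u_z := adj_neq uz; by apply: nbr4; adj.
have [||||a [xa xs Nx]] := @nbr3 x u v y; try adj.
have a_z : a != z.
  apply/eqP => E; apply: (@twin_corner_adj2 u v x y z) => //; last by rewrite -E.
  by have u_z := adj_neq uz; adj.
have x_a := adj_neq xa.
have ya : r y a.
  have [q] := tri xa; rewrite Nx !inE => /or4P[] /eqP ->; rewrite ?rirr // rsym //;
  rewrite ?Nu ?Nv => H; exfalso; apply/negP: H; adj.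
have Ny : forall w, r y w = (w \in [:: u; v; x; a]) by apply: nbr4; adj.
apply/andP; split=> //; apply/eqP/setP => w.
by rewrite !inE Nx Ny !inE; case: (w == x) (w == y) (w == u) (w == v) => [] [] [] [].
Qed.

(* Each adjacent pair of twins in a K4 could serve as the centre of a copy of
   K_{1,1,3}; a fixed ranking of the closed neighbourhoods selects one. *)
Definition chosen u := has_twin u &&
  [forall x in cnbr u, has_twin x ==>
     (enum_rank (cnbr u) <= enum_rank (cnbr x))].

Lemma chosen_cnbr u v : cnbr u = cnbr v -> chosen u -> chosen v.
Proof.
move=> E /andP[/existsP[w /andP[u_w /eqP Ew]] F]; rewrite /chosen -E F andbT.
have [<-|uv] := eqVneq u v; first by apply/existsP; exists w; rewrite /twin u_w Ew /=.
by apply/existsP; exists u; rewrite /twin eq_sym uv E /=.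
Qed.

(** Each closed neighbourhood ranks at most the other, and the ranking is injective. *)
Lemma chosen_adj u v : chosen u -> chosen v -> v \in cnbr u -> cnbr u = cnbr v.
Proof.
move=> /andP[tu /forall_inP cu] /andP[tv /forall_inP cv] uv.
apply/enum_rank_inj/val_inj/eqP; rewrite eqn_leq.
by rewrite (implyP (cu v uv)) // (implyP (cv u _)) // cnbr_sym.
Qed.

(** A twin of [z] would lie in the closed neighbourhood of [u], whose vertices other than [z]
    already have their unique twins among themselves. *)
Lemma two_twin_pairs u v x y z : twin u v -> twin x y ->
  uniq [:: v; x; y; z] -> (forall w, r u w = (w \in [:: v; x; y; z])) ->
  ~~ has_twin z.
Proof.
move=> uv xy us Nu; apply/negP => /existsP[t zt].
have uz : r u z by rewrite Nu !inE eqxx !orbT.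
have : t \in cnbr u.
  by case/andP: (zt) => _ /eqP E; rewrite cnbr_sym -E cnbr_sym in_cnbr uz orbT.
rewrite in_cnbr Nu !inE => /orP[|/or4P[]] /eqP Et; rewrite Et in zt.
- by rewrite twin_sym in zt; move: us; rewrite (twin_unique uv zt) /= !inE eqxx ?orbT ?andbF.
- rewrite twin_sym in zt; rewrite twin_sym in uv; have := adj_neq uz.
  by rewrite (twin_unique uv zt) eqxx.
- by rewrite twin_sym in zt; move: us; rewrite (twin_unique xy zt) /= !inE eqxx ?orbT ?andbF.
- rewrite twin_sym in zt; rewrite twin_sym in xy.
  by move: us; rewrite (twin_unique xy zt) /= !inE eqxx ?orbT ?andbF.
- by case/andP: zt; rewrite eqxx.
Qed.

(** A vertex with a twin loses the selection only to a second twin pair [u], [v] in the same K4. By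
    [two_twin_pairs] no third pair competes with it there, so [u] and [v] are chosen. *)
Lemma not_chosen_twin x : has_twin x -> ~~ chosen x ->
  exists y a u v, [/\ uniq [:: y; u; v; a],
     forall w, r x w = (w \in [:: y; u; v; a]), twin x y, chosen u & chosen v] /\
     [/\ ~~ has_twin a, ~~ r a u & ~~ r a v].
Proof.
move=> tx; rewrite /chosen tx /= => /forall_inPn[u ux].
rewrite negb_imply -ltnNge => /andP[/existsP[v uv] lt_ux].
case/existsP: (tx) => y xy.
have Nuv : cnbr u = cnbr v by case/andP: uv => _ /eqP.
have Nxy : cnbr x = cnbr y by case/andP: xy => _ /eqP.
have Nux : cnbr u != cnbr x by apply: contraTneq lt_ux => ->; rewrite ltnn.
have u_x : u != x by apply: contraNneq Nux => ->.
have u_y : u != y by apply: contraNneq Nux => ->; rewrite Nxy.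
have v_x : v != x by apply: contraNneq Nux => <-; rewrite Nuv.
have v_y : v != y by apply: contraNneq Nux => E; rewrite Nuv E Nxy.
have u_v : u != v by case/andP: uv.
have xu : r x u by move: ux; rewrite in_cnbr (negPf u_x).
have yu : r y u by apply: twin_nbr xy _ _.
have xv : r x v by rewrite rsym; apply: twin_nbr uv _ _; adj.
have yv : r y v by apply: twin_nbr xy _ _.
have xy' := twin_adj xy; have uv' := twin_adj uv.
have x_y := adj_neq xy'.
have [||||a [xa us Nx]] := @nbr3 x y u v; try adj.
have [||||z [uz us' Nu]] := @nbr3 u v x y; try adj.
have x_a := adj_neq xa.
have au : ~~ r a u.
  apply/negP => au; apply: (@twin_corner_adj2 u v x y a) => //; adj.
have cu : chosen u.
  apply/andP; split; first by apply/existsP; exists v.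
  apply/forall_inP => w; rewrite in_cnbr Nu !inE.
  have tz := two_twin_pairs uv xy us' Nu.
  case/orP => [|/or4P[]] /eqP -> //; apply/implyP => // tw.
  - by rewrite Nuv.
  - exact: ltnW.
  - by rewrite -Nxy ltnW.
  - by rewrite tw in tz.
exists y, a, u, v; split; split=> //.
- exact: chosen_cnbr Nuv cu.
- exact: two_twin_pairs xy uv us Nx.
- rewrite twin_sym in uv; apply/negP; rewrite rsym => va.
  by case/negP: au; rewrite rsym; apply: twin_nbr uv _ va; adj.
Qed.

(** * Triangular parts and the part containing a given edge *)

Definition lone x y := [exists z, forall w, (r x w && r y w) == (w == z)].

(** As [a], [b], [c] range over all labellings, any side of the triangle may be the one lying in no
    other triangle. *)
Definition tri_part (p : {set V}) :=
  [exists a, exists b, exists c, [&& p == [set a; b; c], lone a b,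
     [&& r a b, r b c & r a c] & [&& ~~ chosen a, ~~ chosen b & ~~ chosen c]]].

Definition part_of_edge x y z := [/\ r x z, r y z, tri_part [set x; y; z] &
  forall w, r x w -> r y w -> tri_part [set x; y; w] -> w = z].

Lemma loneP x y z : r x z -> r y z ->
  (forall w, r x w -> r y w -> w = z) -> lone x y.
Proof.
move=> xz yz H; apply/existsP; exists z; apply/forallP => w.
by apply/eqP; apply/andP/eqP => [[xw yw]|->]; [exact: H | split].
Qed.

Lemma lone_sym x y : lone x y = lone y x.
Proof.
by apply/existsP/existsP => -[z /forallP H]; exists z; apply/forallP => w; rewrite andbC.
Qed.

Lemma lone_eq x y z w : lone x y -> r x z -> r y z -> r x w -> r y w -> z = w.
Proof.
case/existsP => t /forallP H xz yz xw yw.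
have := H z; have := H w; rewrite xz yz xw yw.
by move=> /eqP/esym/eqP -> /eqP/esym/eqP ->.
Qed.

Lemma tri_part_chosen p x : tri_part p -> x \in p -> ~~ chosen x.
Proof.
case/existsP => a /existsP[b /existsP[c /and4P[/eqP -> _ _ /and3P[ca cb cc]]]].
by rewrite !inE => /orP[/orP[]|] /eqP ->.
Qed.

Lemma tri_part_intro a b c : lone a b -> r a b -> r b c -> r a c ->
  ~~ chosen a -> ~~ chosen b -> ~~ chosen c -> tri_part [set a; b; c].
Proof.
move=> H1 H2 H3 H4 H5 H6 H7; apply/existsP; exists a; apply/existsP; exists b.
by apply/existsP; exists c; apply/and4P; split=> //; apply/and3P.
Qed.

Lemma tri_part_third p x y : tri_part p -> x \in p -> y \in p -> x != y ->
  exists z, [/\ p = [set x; y; z], r x y, r x z & r y z].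
Proof.
case/existsP => a /existsP[b /existsP[c /and4P[/eqP -> _ /and3P[ab bc ac] _]]].
rewrite !inE => /orP[/orP[]|] /eqP -> /orP[/orP[]|] /eqP ->; rewrite ?eqxx // => _;
 [exists c|exists b|exists c|exists a|exists b|exists a]; split; try adj;
 apply/setP => w; rewrite !inE; case: (w == a) (w == b) (w == c) => [] [] [] //.
Qed.

Lemma tri_part_lone x y z : tri_part [set x; y; z] ->
  [\/ lone x y, lone x z | lone y z].
Proof.
case/existsP => a /existsP[b /existsP[c /and4P[/eqP E ab /and3P[/adj_neq ne _ _] _]]].
have : b \in [set x; y; z] by rewrite E !inE eqxx !orbT.
have : a \in [set x; y; z] by rewrite E !inE eqxx.
rewrite !inE => /orP[/orP[]|] /eqP Ea /orP[/orP[]|] /eqP Eb;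
  move: ab ne; rewrite Ea Eb ?eqxx // => l _;
  first [by constructor 1 | by constructor 2 | by constructor 3 | rewrite lone_sym in l];
  first [by constructor 1 | by constructor 2 | by constructor 3].
Qed.

Lemma window_none a b x c d : ~~ window a b x c d.
Proof.
by apply/negP => /window_square_cycle[n [v]]; apply: not_square.
Qed.

Lemma part_of_edge_sym x y z : part_of_edge x y z -> part_of_edge y x z.
Proof.
have E w : [set x; y; w] = [set y; x; w] by rewrite [[set x; y]]setUC.
by case=> xz yz; rewrite E => T U; split=> // w yw xw; rewrite -E; apply: U.
Qed.

(** The neighbourhood of [p] is the path a-q-b-m, so [pa] is lone and [pqa] is a part. If [pqb] were
    one too, its lone edge could only be [qb], which would give a window centred at [p]. *)
Lemma half_octahedron p q a b m : (forall w, r p w = (w \in [:: q; a; b; m])) ->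
  uniq [:: q; a; b; m] -> r q a -> r q b -> ~~ r q m -> ~~ r a b ->
  r m b -> ~~ r m a -> ~~ chosen p -> ~~ chosen q -> ~~ chosen a ->
  part_of_edge p q a.
Proof.
move=> Np us qa qb qm ab mb ma cp cq ca.
have [pq pa pb pm] : [/\ r p q, r p a, r p b & r p m].
  by rewrite !Np !inE !eqxx ?orbT.
have lpa : lone p a.
  apply: (@loneP _ _ q) => //; first adj.
  move=> w; rewrite Np !inE => /or4P[] /eqP -> //; rewrite ?rirr // 1?rsym.
    by rewrite rsym (negPf ab).
  by rewrite (negPf ma).
split=> //.
  have -> : [set p; q; a] = [set p; a; q] by rewrite setUAC.
  by apply: tri_part_intro => //; adj.
move=> w; rewrite Np !inE => /or4P[] /eqP -> //; rewrite ?rirr ?(negPf qm) // => _.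
case/tri_part_lone => l.
- by apply: (lone_eq l).
- have q_m : q != m by adj.
  by case/eqP: q_m; apply: (lone_eq l) => //; adj.
exfalso; case/negP: (window_none a q p b m).
have p_q := adj_neq pq; have p_a := adj_neq pa; have p_b := adj_neq pb.
have p_m := adj_neq pm.
apply/and5P; split; first adj.
- by rewrite /= pa pq pb pm.
- by rewrite (rsym a) qa qb (rsym b) mb.
- by rewrite ab qm rsym ma.
apply/forallP => t; apply/implyP => /andP[qt bt]; apply/eqP.
by apply: (lone_eq l) => //; adj.
Qed.

(* An edge [pq] in two triangles [pqa] and [pqb]: exactly one of them is a part,
   unless [p, q, a, b] and two more vertices form an octahedron. *)
Lemma part_of_edge_two p q a b m : (forall w, r p w = (w \in [:: q; a; b; m])) ->
  uniq [:: q; a; b; m] -> r q a -> r q b -> ~~ r q m ->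
  ~~ has_twin p -> ~~ chosen p -> ~~ chosen q -> ~~ chosen a -> ~~ chosen b ->
  exists z, part_of_edge p q z.
Proof.
move=> Np us qa qb qm tp cp cq ca cb.
have [pq pa pb pm] : [/\ r p q, r p a, r p b & r p m].
  by rewrite !Np !inE !eqxx ?orbT.
have p_q := adj_neq pq; have p_a := adj_neq pa; have p_b := adj_neq pb.
have p_m := adj_neq pm.
have not_twin w : p != w -> cnbr p != cnbr w.
  by move=> pw; apply: contraNneq tp => E; apply/existsP; exists w; rewrite /twin pw E /=.
have mab : r m a || r m b.
  have [w] := tri pm; rewrite Np !inE => /or4P[] /eqP ->; rewrite ?rirr //.
  - by rewrite rsym (negPf qm).
  - by move=> ->.
  - by move=> ->; rewrite orbT.
(* Otherwise [p] would be a twin of whichever of [a], [b] is adjacent to [m]. *)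
have ab : ~~ r a b.
  apply/negP => ab.
  case/orP: mab => mc.
    have Na : forall w, r a w = (w \in [:: p; q; b; m]) by apply: nbr4; adj.
    case/negP: (not_twin _ p_a); apply/eqP/setP => w; rewrite !inE Np Na !inE.
    by case: (w == p) (w == a) (w == q) (w == b) (w == m) => [] [] [] [] [].
  have Nb : forall w, r b w = (w \in [:: p; q; a; m]) by apply: nbr4; adj.
  case/negP: (not_twin _ p_b); apply/eqP/setP => w; rewrite !inE Np Nb !inE.
  by case: (w == p) (w == a) (w == q) (w == b) (w == m) => [] [] [] [] [].
have us' : uniq [:: q; b; a; m] by adj.
have Np' : forall w, r p w = (w \in [:: q; b; a; m]) by apply: nbr4; adj.
have ba : ~~ r b a by rewrite rsym.
have [mb|mb] := boolP (r m b); have [ma|ma] := boolP (r m a); last first.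
- by move: mab; rewrite (negPf ma) (negPf mb).
- by exists b; apply: (half_octahedron Np').
- by exists a; apply: (half_octahedron Np).
(* Now [m] is adjacent to both [a] and [b]. The argument is repeated from [q], with [m'] as its
   fourth neighbour. *)
have [||||m' [qm' vs Nq]] := @nbr3 q p a b; try adj.
have q_m' := adj_neq qm'.
have pm' : ~~ r p m'.
  rewrite Np; apply/negP => E; have mm' : m' != m by apply: contraNneq qm => <-.
  by apply/negP: E; adj.
have vs' : uniq [:: p; b; a; m'] by adj.
have Nq' : forall w, r q w = (w \in [:: p; b; a; m']) by apply: nbr4; adj.
have mab' : r m' a || r m' b.
  have [w] := tri qm'; rewrite Nq !inE => /or4P[] /eqP ->; rewrite ?rirr //.
  - by rewrite rsym (negPf pm').
  - by move=> ->.
  - by move=> ->; rewrite orbT.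
have [mb'|mb'] := boolP (r m' b); have [ma'|ma'] := boolP (r m' a); last first.
- by move: mab'; rewrite (negPf ma') (negPf mb').
- by exists b; apply/part_of_edge_sym/(half_octahedron Nq').
- by exists a; apply/part_of_edge_sym/(half_octahedron Nq).
have m_m' : m != m' by apply: contraNneq pm' => <-.
have Na : forall w, r a w = (w \in [:: p; q; m; m']) by apply: nbr4; adj.
have Nb : forall w, r b w = (w \in [:: p; q; m; m']) by apply: nbr4; adj.
have m_a := adj_neq ma; have m_b := adj_neq mb.
have [||||n [mn ws Nm]] := @nbr3 m p a b; try adj.
have m_n := adj_neq mn.
have q_n : n != q by apply: contraNneq qm => <-; rewrite rsym.
have a_m' := adj_neq ma'; have b_m' := adj_neq mb'.
(* If the fourth neighbour [n] of [m] is [m'], the six vertices form an octahedron, which is C_6^2: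
   the list puts the nonadjacent pairs [p m'], [q m], [a b] three apart. Otherwise [mn] lies in no
   triangle. *)
have [En|n_m'] := eqVneq n m'.
  rewrite En in mn.
  exfalso; apply: (@not_square 6 _ (@square_cyclic_seq p [:: p; q; a; m'; m; b] _ _ _)).
  + by [].
  + adj.
  rewrite /= pq pa qa qm' mb (rsym a m') ma' (rsym a m) ma (rsym m' m) mn mb'.
  by rewrite (rsym m p) pm (rsym b p) pb (rsym b q) qb.
exfalso; have [w] := tri mn; rewrite Nm !inE => /or4P[] /eqP ->; rewrite ?rirr // rsym.
- by rewrite Np => H; apply/negP: H; adj.
- by rewrite Na => H; apply/negP: H; adj.
- by rewrite Nb => H; apply/negP: H; adj.
Qed.

Lemma chosen_twin x : chosen x -> has_twin x.
Proof. by case/andP. Qed.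

(** By the number of common neighbours: three would make [p] and [q] twins, two is
    [part_of_edge_two], and one makes the edge lone. *)
Lemma part_of_edge_plain p q : r p q -> ~~ has_twin p -> ~~ has_twin q ->
  exists z, part_of_edge p q z.
Proof.
move=> pq tp tq.
have p_q := adj_neq pq.
have cp := contra (@chosen_twin p) tp; have cq := contra (@chosen_twin q) tq.
(* A chosen [z] would have [p] and [q] as adjacent corners of its twin pair, hence as twins. *)
have chosen_common z : r p z -> r q z -> ~~ chosen z.
  move=> pz qz; apply/negP => /chosen_twin/existsP[z' zz'].
  have zp : z' != p.
    by apply: contraNneq tp => E; apply/existsP; exists z; rewrite twin_sym -E.
  have zq : z' != q.
    by apply: contraNneq tq => E; apply/existsP; exists z; rewrite twin_sym -E.
  by case/existsP: tp; exists q; apply: (adj_corners_twin zz'); adj.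
have [z pz qz] := tri pq.
have q_z := adj_neq qz.
have [|||s [m [ps pm us Np]]] := @nbr2 p q z; try adj.
have [qs|qs] := boolP (r q s); have [qm|qm] := boolP (r q m).
- case/existsP: tp; exists q; rewrite /twin p_q; apply/eqP/setP => w.
  have p_z := adj_neq pz; have p_s := adj_neq ps; have p_m := adj_neq pm.
  have Nq : forall w, r q w = (w \in [:: p; z; s; m]) by apply: nbr4; adj.
  rewrite !inE Np Nq !inE.
  by case: (w == p) (w == q) (w == z) (w == s) (w == m) => [] [] [] [] [].
- by apply: (part_of_edge_two Np); auto.
- apply: (@part_of_edge_two p q z m s); try adj; auto.
  by apply: nbr4; adj.
exists z; have lpq : lone p q.
  apply: (loneP pz qz) => w; rewrite Np !inE => /or4P[] /eqP ->; rewrite ?rirr //.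
    by rewrite (negPf qs).
  by rewrite (negPf qm).
split=> //; first by apply: tri_part_intro => //; auto.
by move=> w pw qw _; apply: (lone_eq lpq).
Qed.

(** With [b] the twin of [x] and [u], [v] the chosen pair of their K4, the part is the triangle
    [xba]: its edge [xa] is lone, and the other triangles on [xb] contain [u] or [v]. *)
Lemma part_of_edge_twin x y : r x y -> has_twin x -> ~~ chosen x -> ~~ chosen y ->
  exists z, part_of_edge x y z.
Proof.
move=> xy tx cx cy.
have [b [a [u [v [[us Nx tb cu cv] [ta au av]]]]]] := not_chosen_twin tx cx.
have xb := twin_adj tb.
have xa : r x a by rewrite Nx !inE eqxx !orbT.
have ba : r b a by apply: twin_nbr tb _ xa; adj.
have cb : ~~ chosen b.
  by apply: contra cx; apply: chosen_cnbr; case/andP: tb => _ /eqP.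
have ca := contra (@chosen_twin a) ta.
have lxa : lone x a.
  apply: (@loneP _ _ b) => //; first adj.
  move=> w; rewrite Nx !inE => /or4P[] /eqP ->; rewrite ?rirr //.
    by rewrite (negPf au).
  by rewrite (negPf av).
have T : tri_part [set x; a; b] by apply: tri_part_intro => //; adj.
have cw w z : tri_part [set x; z; w] -> ~~ chosen w.
  by move/tri_part_chosen; apply; rewrite !inE eqxx orbT.
move: xy cy; rewrite Nx !inE => /or4P[] /eqP -> cy.
- exists a; split=> //; first by rewrite setUAC.
  move=> w; rewrite Nx !inE => /or4P[] /eqP ->; rewrite ?rirr // => _ /cw.
    by rewrite cu.
  by rewrite cv.
- by rewrite cu in cy.
- by rewrite cv in cy.
exists b; split=> //; first adj.
by move=> w xw aw _; apply: (lone_eq lxa) => //; adj.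
Qed.

Lemma part_of_edge_exists x y : r x y -> ~~ chosen x -> ~~ chosen y ->
  exists z, part_of_edge x y z.
Proof.
move=> xy cx cy; have [tx|tx] := boolP (has_twin x).
  exact: part_of_edge_twin.
have [ty|ty] := boolP (has_twin y); last exact: part_of_edge_plain.
have [|z /part_of_edge_sym] := @part_of_edge_twin y x _ ty cy cx; first adj.
by exists z.
Qed.

(** * The decomposition of a quartic graph *)

Definition parts := [set p | tri_part p] :|: [set cnbr u | u in chosen].

Definition part_centre (p : {set V}) := [set u in p | chosen u && (cnbr u == p)].

Lemma tri_part_centre p : tri_part p -> part_centre p = set0.
Proof.
move=> T; apply/setP => x; rewrite !inE.
by case: (boolP (x \in p)) => // /(tri_part_chosen T)/negPf ->.
Qed.

Lemma in_part_centre u x : chosen u -> (x \in part_centre (cnbr u)) = (cnbr x == cnbr u).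
Proof.
move=> cu; rewrite inE; apply/and3P/eqP => [[_ _ /eqP //]|E].
by split; [rewrite -E mem_cnbr | apply: chosen_cnbr cu | apply/eqP].
Qed.

Lemma partsP p : p \in parts -> tri_part p \/ exists2 u, chosen u & p = cnbr u.
Proof.
by rewrite !inE => /orP[|/imsetP[u cu ->]]; [left | right; exists u].
Qed.

Lemma quartic_decomposition : decomposition r parts part_centre.
Proof.
have card_c u : chosen u -> #|part_centre (cnbr u)| = 2.
  move=> cu; have [v uv] := existsP (chosen_twin cu).
  have -> : part_centre (cnbr u) = [set u; v].
    apply/setP => x; rewrite in_part_centre // !inE; apply/eqP/orP => [E|].
      have [|x_u] := eqVneq x u; [by left | right; apply/eqP].
      by apply: (@twin_unique u) => //; rewrite /twin eq_sym x_u E /=.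
    by case=> /eqP -> //; case/andP: uv => _ /eqP.
  by rewrite cards2; case/andP: uv => ->.
have sub p : part_centre p \subset p by apply/subsetP => x; rewrite inE => /andP[].
(* A triangular part avoids chosen vertices, and adjacent chosen vertices have the same closed
   neighbourhood. *)
have cent_only p q x : p \in parts -> q \in parts -> x \in part_centre p -> x \in q -> q = p.
  move=> _ /partsP[T|[u cu ->]]; rewrite inE => /and3P[_ cx /eqP <-].
    by move/(tri_part_chosen T); rewrite cx.
  exact: chosen_adj.
split=> //.
- move=> p /partsP[T|[u cu ->]].
    rewrite tri_part_centre // setD0.
    case/existsP: T => a /existsP[b /existsP[c /and4P[/eqP -> _ /and3P[ab bc ac] _]]].
    have a_b := adj_neq ab; have b_c := adj_neq bc; have a_c := adj_neq ac.
    by apply: card_set3; adj.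
  by rewrite cardsDS // card_c // card_cnbr.
- by move=> p /partsP[T|[u cu ->]]; [left; apply: tri_part_centre | right; apply: card_c].
- move=> p x y /partsP[T|[u cu ->]] /and4P[x_y xp yp].
    by have [z []] := tri_part_third T xp yp x_y.
  have [u' u'p] : exists u', u' \in part_centre (cnbr u).
    by exists u; rewrite in_part_centre.
  have -> /= : (part_centre (cnbr u) == set0) = false.
    by apply/eqP => E; rewrite E inE in u'p.
  rewrite !in_part_centre // => /orP[] /eqP E.
    by move: yp; rewrite -E in_cnbr eq_sym (negPf x_y).
  by move: xp; rewrite -E in_cnbr (negPf x_y) rsym.
- move=> x y xy; have x_y := adj_neq xy.
  have [cx|cx] := boolP (chosen x).
    exists (cnbr x); first by rewrite !inE imset_f ?orbT.
    by rewrite /part_edge x_y mem_cnbr in_cnbr xy in_part_centre // eqxx !orbT.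
  have [cy|cy] := boolP (chosen y).
    exists (cnbr y); first by rewrite !inE imset_f ?orbT.
    by rewrite /part_edge x_y mem_cnbr in_cnbr (rsym y) xy !in_part_centre // eqxx !orbT.
  have [z [xz yz T _]] := part_of_edge_exists xy cx cy.
  exists [set x; y; z]; first by rewrite inE inE T.
  by rewrite /part_edge x_y tri_part_centre // eqxx !inE !eqxx !orbT.
(* A centre vertex at [x] or [y] determines the part; otherwise both parts are triangles, and the
   uniqueness in [part_of_edge] applies. *)
move=> p q x y pF qF /and4P[x_y xp yp cp] /and4P[_ xq yq cq].
case/or3P: cp => [/eqP cp|cp|cp]; try by apply/esym; apply: (cent_only _ _ _ _ _ cp).
case/or3P: cq => [/eqP cq|cq|cq]; try by apply: (cent_only _ _ _ _ _ cq).
have tri0 p' : p' \in parts -> part_centre p' = set0 -> tri_part p'.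
  case/partsP => // -[u cu -> E].
  by have := in_part_centre u cu; rewrite E inE eqxx.
have Tp := tri0 _ pF cp; have Tq := tri0 _ qF cq.
have [z [Ep xy xz yz]] := tri_part_third Tp xp yp x_y.
have [w [Eq _ xw yw]] := tri_part_third Tq xq yq x_y.
have [t [_ _ _ U]] := part_of_edge_exists xy (tri_part_chosen Tp xp) (tri_part_chosen Tp yp).
by rewrite Ep Eq (U z) // -?Ep // (U w) // -?Eq.
Qed.

End Quartic.

Lemma set3P (T : finType) (A : {set T}) : #|A| = 3 ->
  exists a b c, uniq [:: a; b; c] /\ A = [set a; b; c].
Proof.
rewrite cardE => sA; case E: (enum A) sA => [|a [|b [|c []]]] // _.
exists a, b, c; rewrite -E enum_uniq; split=> //.
by apply/setP => x; rewrite -mem_enum E !inE orbA.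
Qed.

(** * From a decomposition to a sequence of operations *)

Lemma inj_surj_bij (A B : finType) (f : A -> B) :
  injective f -> (forall y, exists x, f x = y) -> bijective f.
Proof.
move=> inj surj; apply: inj_card_bij => //; rewrite -(card_codom inj).
by apply/subset_leq_card/subsetP => y _; have [x <-] := surj y; apply: codom_f.
Qed.

Lemma isomorphic_sym (G H : mgraph) : isomorphic G H -> isomorphic H G.
Proof.
case=> f [g [[f' fK f'K] [g' gK g'K] E]]; exists f', g'; split; try by [exists f | exists g].
move=> e; rewrite -{2}[e]g'K E -imset_comp -[LHS]imset_id.
by apply: eq_imset => x /=; rewrite fK.
Qed.

Lemma endsP (G : mgraph) (e : edge G) : exists x y, x != y /\ ends e = [set x; y].
Proof. by apply/cards2P; rewrite card_ends. Qed.

Section Decomposition.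

Variables (V : finType) (r : rel V) (F : {set {set V}}).
Variable centre : {set V} -> {set V}.
Hypothesis dec : decomposition r F centre.

Local Notation pe := (part_edge centre).

Lemma part_edge_sym p x y : pe p x y = pe p y x.
Proof.
rewrite /part_edge eq_sym (orbC (x \in centre p)).
by case: (x \in p) (y \in p) => [] [].
Qed.

(** Each part through [x] uses exactly two of its edges: those to the other two corners of a
    triangle, or those to the two centre vertices of a K_{1,1,3}. *)
Lemma card_parts_at x : (forall p, p \in F -> x \notin centre p) ->
  (#|[set p in F | x \in p]|).*2 = #|[set y | r x y]|.
Proof.
move=> xc.
(* The default [set0] is never reached at a neighbour of [x], by [part_exists]. *)
pose part y := odflt set0 [pick p | (p \in F) && pe p x y].
have partE p y : p \in F -> r x y -> (part y == p) = pe p x y.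
  move=> pF xy; rewrite /part; case: pickP => [q /andP[qF qxy]|no] /=.
    by apply/eqP/idP => [<- //|pxy]; apply: (part_unique dec) qF pF qxy pxy.
  by have [q qF qxy] := part_exists dec xy; have := no q; rewrite qF /= qxy.
rewrite -[RHS]sum1_card (partition_big part [in [set p in F | x \in p]]) /=; last first.
  move=> y; rewrite !inE => xy; have [p pF pxy] := part_exists dec xy.
  have /eqP -> : part y == p by rewrite partE.
  by rewrite pF; case/and4P: pxy.
rewrite -muln2 -sum_nat_const; apply/esym/eq_bigr => p; rewrite inE => /andP[pF xp].
have -> : \sum_(y in [set y | r x y] | part y == p) 1 = #|[set y | pe p x y]|.
  rewrite sum1dep_card; apply: eq_card => y; rewrite !inE.
  apply/andP/idP => [[xy]|pxy]; first by rewrite partE.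
  have xy := part_adj dec pF pxy.
  by rewrite partE.
have [c0|c2] := card_centre dec pF.
  have := card_corners dec pF; rewrite c0 setD0 (cardsD1 x) xp => -[<-].
  by apply: eq_card => y; rewrite !inE /part_edge c0 eqxx xp orTb andbT /= eq_sym.
rewrite -c2; apply: eq_card => y; rewrite !inE /part_edge xp (negPf (xc p pF)) /=.
have -> /= : (centre p == set0) = false by apply/eqP => E; rewrite E cards0 in c2.
apply/and3P/idP => [[] //|yp]; split=> //; last exact: (subsetP (centre_sub dec p)).
by apply: contraTneq yp => <-; apply: xc.
Qed.

(** * Intermediate stages of the construction *)

(** The vertices present at stage [D]: centres of parts outside [D] have not been added yet. *)
Definition alive (D : {set {set V}}) x := [forall p in F, (x \in centre p) ==> (p \in D)].

(* [D] is the set of the parts K_{1,1,3} already introduced; a part that is not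
   in [D] contributes the triangle on its corners. *)
Definition stage_edge (D : {set {set V}}) (p : {set V}) x y :=
  [&& x != y, x \in p, y \in p &
   if p \in D then (x \in centre p) || (y \in centre p)
   else (x \notin centre p) && (y \notin centre p)].

Lemma stage_edge_sym D p x y : stage_edge D p x y = stage_edge D p y x.
Proof.
rewrite /stage_edge eq_sym (orbC (x \in centre p)) (andbC (x \notin centre p)).
by case: (x \in p) (y \in p) => [] [].
Qed.

Lemma stage_edge_alive D p x y : p \in F -> stage_edge D p x y -> alive D x.
Proof.
move=> pF /and4P[_ xp yp c]; apply/forall_inP => q qF; apply/implyP => xq.
have E := centre_part dec qF pF xq xp; rewrite -E in xq *.
by move: c; case: (p \in D) => //; rewrite xq.
Qed.

(** The triangle is found inside the part: a side of a triangle is completed by the third corner, an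
    edge between centre vertices by a corner, and an edge from a centre vertex to a corner by the
    other centre vertex. Deleting a triangle of another part therefore does no harm. *)
Lemma stage_edge_triangle (D : {set {set V}}) p x y : p \in F -> D \subset [set p | centre p != set0] ->
  stage_edge D p x y -> exists2 z, stage_edge D p x z & stage_edge D p y z.
Proof.
move=> pF sD; rewrite /stage_edge => /and4P[x_y xp yp].
have [a [b [c [us E]]]] := set3P (card_corners dec pF).
have corner w : (w \notin centre p) && (w \in p) = (w \in [:: a; b; c]).
  by rewrite -in_setD E !inE orbA.
case: ifP => [pD|_]; last first.
  case/andP => xc yc.
  have: x \in [:: a; b; c] by rewrite -corner xc.
  have: y \in [:: a; b; c] by rewrite -corner yc.
  have: [&& (a \notin centre p) && (a \in p), (b \notin centre p) && (b \in p) & (c \notin centre p) && (c \in p)].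
    by rewrite !corner !inE !eqxx !orbT.
  case/and3P=> /andP[ac ap] /andP[bc bp] /andP[cc cp].
  split_hyps.
  rewrite !inE => /or3P[] /eqP Ey /or3P[] /eqP Ex; move: x_y; rewrite Ex Ey ?eqxx //= => _;
   [exists c|exists b|exists c|exists a|exists b|exists a];
   repeat (apply/andP; split); neq_bool.
have [u [v [uv Ec]]] : exists u v, u != v /\ centre p = [set u; v].
  have [c0|/eqP/cards2P[u [v Ec]]] := card_centre dec pF; last by exists u, v.
  by have := subsetP sD _ pD; rewrite inE c0 eqxx.
have [up vp] : u \in p /\ v \in p.
  by split; apply: (subsetP (centre_sub dec p)); rewrite Ec !inE eqxx ?orbT.
have [xc|xc] := boolP (x \in centre p); have [yc|yc] := boolP (y \in centre p) => // _.
- have /andP[ac ap] : (a \notin centre p) && (a \in p) by rewrite corner inE eqxx.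
  exists a; rewrite ap /= ?xp ?yp ?orbT ?andbT.
    by apply: contraNneq ac => <-.
  by apply: contraNneq ac => <-.
- move: xc yc x_y; rewrite Ec !inE negb_or => /orP[]/eqP -> /andP[yu yv] _.
    by exists v; rewrite ?inE ?uv ?yv ?up ?yp ?vp ?eqxx ?orbT.
  by exists u; rewrite ?inE ?(eq_sym v) ?uv ?yu ?up ?vp ?yp ?eqxx ?orbT.
move: xc yc x_y; rewrite Ec !inE negb_or => /andP[yu yv] /orP[]/eqP -> _.
  by exists v; rewrite ?inE ?uv ?yv ?up ?xp ?vp ?eqxx ?orbT.
by exists u; rewrite ?inE ?(eq_sym v) ?uv ?yu ?up ?vp ?xp ?eqxx ?orbT.
Qed.

(** Edges of [H] are indexed by a part together with a pair of ends, so parallel edges come from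
    different parts. *)
Record represents (H : mgraph) (D : {set {set V}}) (f : vert H -> V)
    (part : edge H -> {set V}) : Prop := Represents {
  rep_inj : injective f;
  rep_alive : forall w, alive D (f w);
  rep_vert : forall x, alive D x -> exists w, f w = x;
  rep_part : forall e, part e \in F;
  rep_ends : forall e, exists x y, ends e = [set x; y] /\ stage_edge D (part e) (f x) (f y);
  rep_edge_inj : forall e e', ends e = ends e' -> part e = part e' -> e = e';
  rep_edge : forall p x y, p \in F -> stage_edge D p (f x) (f y) ->
    exists2 e, ends e = [set x; y] & part e = p }.

Hypothesis deg4 : forall x, #|[set y | r x y]| = 4.

(** * The cubic multigraph of parts *)

Definition part_mgraph_ends (x : {x : V | alive set0 x}) := [set p : {p | p \in F} | val x \in val p].

Lemma alive0P x : reflect (forall p, p \in F -> x \notin centre p) (alive set0 x).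
Proof.
apply: (iffP forall_inP) => H p pF; last by rewrite (negPf (H p pF)).
by apply/negP => xp; have := H p pF; rewrite xp inE.
Qed.

(** Four edges at the vertex, two in each part through it. *)
Lemma card_part_mgraph_ends x : #|part_mgraph_ends x| = 2.
Proof.
apply/double_inj; rewrite -[RHS]/4 -(deg4 (val x)) -card_parts_at; last exact/alive0P/(valP x).
congr _.*2; rewrite -(card_imset _ val_inj); apply: eq_card => p; rewrite inE.
apply/imsetP/andP => [[q]|[pF xp]]; first by rewrite inE => xq ->; split=> //; apply: valP.
by exists (Sub p pF); rewrite ?inE ?SubK.
Qed.

Definition part_mgraph : mgraph := MGraph card_part_mgraph_ends.

(** By [centre_part], a corner of [p] is a centre vertex of no part at all, so the corners of [p]
    are exactly its vertices that serve as edges of the multigraph of parts. *)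
Lemma in_corners p x : p \in F ->
  (x \in p :\: centre p) = (x \in p) && alive set0 x.
Proof.
move=> pF; rewrite inE andbC; have [xp|//] := boolP (x \in p); rewrite /=.
apply/idP/alive0P => [xc q qF|]; last exact.
by apply: contra xc => xq; rewrite (centre_part dec qF pF xq xp).
Qed.

Lemma part_mgraph_cubic : regular 3 part_mgraph.
Proof.
move=> p; rewrite -(card_corners dec (valP p)) /degree -(card_imset _ val_inj).
apply: eq_card => x; rewrite in_corners ?(valP p) //.
apply/imsetP/andP => [[y]|[xp xa]]; first by rewrite !inE => yp ->; split=> //; apply: valP.
by exists (Sub x xa); rewrite ?inE ?SubK.
Qed.

(** An edge [({x, y}, p)] of the line multigraph is a side of the triangle on the corners of [p],
    and at stage [set0] every part is such a triangle. *)
Lemma represents_line :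
  @represents (line_mgraph part_mgraph) set0 val (fun e => val (val e).2).
Proof.
split.
- exact: val_inj.
- exact: valP.
- by move=> x xa; exists (Sub x xa).
- by move=> e; apply: valP.
- move=> e; have /andP[c2 /forall_inP inc] := valP e.
  case/cards2P: c2 => x [y [xy E]]; exists x, y; split=> //.
  have /(_ x) := inc; have /(_ y) := inc; rewrite E !inE !eqxx orbT => yp xp.
  move: (yp isT) (xp isT) => {}yp {}xp.
  rewrite /stage_edge inE xp yp (inj_eq val_inj) xy /=.
  by rewrite (alive0P _ (valP x)) ?(alive0P _ (valP y)) //; apply: valP.
- move=> [[A p] eA] [[B q] eB] /= AB /val_inj pq; apply: val_inj => /=.
  by rewrite AB pq.
move=> p x y pF /and4P[xy xp yp _].
have le : line_edge (M := part_mgraph) ([set x; y], Sub p pF).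
  rewrite /line_edge /= cards2; rewrite (inj_eq val_inj) in xy; rewrite xy /=.
  by apply/forall_inP => z; rewrite !inE => /orP[] /eqP ->.
by exists (Sub _ le).
Qed.

(** * One replacement of a triangle *)

Section Step.

Variables (H : mgraph) (D : {set {set V}}) (f : vert H -> V) (part : edge H -> {set V}).
Hypotheses (rep : represents D f part) (sD : D \subset [set p | centre p != set0]).
Variable t : {set V}.
Hypotheses (tF : t \in F) (tD : t \notin D).

Local Notation T := [set e | part e == t].

Lemma stage_edge_out x y : stage_edge D t x y =
  [&& x != y, x \in t :\: centre t & y \in t :\: centre t].
Proof.
rewrite /stage_edge (negPf tD) !inE.
by case: (x \in t) (y \in t) (x \in centre t) (y \in centre t) => [] [] [] [].
Qed.

Lemma rep_corner x : x \in t :\: centre t -> exists w, f w = x.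
Proof.
rewrite in_corners // => /andP[_ xa]; apply: (rep_vert rep).
apply/forall_inP => p pF; apply/implyP => xp.
by have := alive0P _ xa p pF; rewrite xp.
Qed.

Lemma in_corners_out w : (w \in corners T) = (f w \in t :\: centre t).
Proof.
apply/bigcupP/idP => [[e]|wt].
  rewrite inE => /eqP et; have [x [y [->]]] := rep_ends rep e.
  by rewrite et stage_edge_out !inE => /and3P[_ xt yt] /orP[] /eqP ->.
(* A second corner provides an edge of the triangle that ends at [w]. *)
have [z zt zw] : exists2 z, z \in t :\: centre t & f w != z.
  have := card_corners dec tF; rewrite (cardsD1 (f w)) wt add1n => -[c2].
  have /card_gt0P[z] : 0 < #|(t :\: centre t) :\ f w| by rewrite c2.
  by rewrite !inE eq_sym => /andP[zw zt]; exists z => //; rewrite !inE.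
have [z' Ez] := rep_corner zt.
have [|e ee et] := @rep_edge _ _ _ _ rep t w z' tF.
  by rewrite stage_edge_out Ez zw wt zt.
by exists e; rewrite ?inE ?et ?ee ?inE ?eqxx.
Qed.

Lemma triangle_out : triangle T.
Proof.
have [a [b [c [us E]]]] := set3P (card_corners dec tF).
have [x Ex] : exists w, f w = a by apply: rep_corner; rewrite E !inE eqxx.
have [y Ey] : exists w, f w = b by apply: rep_corner; rewrite E !inE eqxx !orbT.
have [z Ez] : exists w, f w = c by apply: rep_corner; rewrite E !inE eqxx !orbT.
have us' : uniq [:: x; y; z] by rewrite -(map_inj_uniq (rep_inj rep)) /= Ex Ey Ez.
have ed u v : u \in [:: x; y; z] -> v \in [:: x; y; z] -> u != v ->
    exists2 e, ends e = [set u; v] & part e = t.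
  move=> uE vE uv; apply: (rep_edge rep) => //.
  rewrite stage_edge_out (inj_eq (rep_inj rep)) uv E !inE /=.
  by move: uE vE; rewrite !inE -Ex -Ey -Ez !(inj_eq (rep_inj rep)) !orbA => -> ->.
have [x_y y_z z_x] : [/\ x != y, y != z & z != x].
  by split; split_hyps; neq_bool.
have [|| |e1 d1 p1] := ed x y; rewrite ?inE ?eqxx ?orbT //.
have [|| |e2 d2 p2] := ed y z; rewrite ?inE ?eqxx ?orbT //.
have [|| |e3 d3 p3] := ed z x; rewrite ?inE ?eqxx ?orbT //.
exists x, y, z, e1, e2, e3; split=> //.
apply/setP => e; rewrite !inE; apply/eqP/idP => [et|]; last first.
  by case/orP=> [/orP[]|] /eqP ->.
have [u [v [ee]]] := rep_ends rep e; rewrite et stage_edge_out.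
have inx w : f w \in [set a; b; c] -> w \in [:: x; y; z].
  by rewrite !inE -Ex -Ey -Ez !(inj_eq (rep_inj rep)) orbA.
rewrite (inj_eq (rep_inj rep)) E => /and3P[uv /inx uE /inx vE].
have same e' : ends e' = [set u; v] -> part e' = t -> e == e'.
  by move=> d p; apply/eqP/(rep_edge_inj rep); rewrite ?d ?p.
move: uE vE uv; rewrite !inE.
case/or3P=> /eqP Eu /or3P[]/eqP Ev; rewrite Eu Ev in same *; rewrite ?eqxx // => _.
- by rewrite (same e1).
- by rewrite (same e3) ?orbT // setUC.
- by rewrite (same e1) ?orbT // setUC.
- by rewrite (same e2) ?orbT.
- by rewrite (same e3) ?orbT.
- by rewrite (same e2) ?orbT // setUC.
Qed.

Lemma eligible_out : eligible T.
Proof.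
split; first exact: triangle_out.
(* A surviving edge has a triangle within its own part, which is not [t], so no side of that
   triangle is deleted. *)
left=> -[e eT]; have [x [y [ee s]]] := rep_ends rep e.
have pF := rep_part rep e; have pt : part e != t by rewrite inE in eT.
have [z' xz yz] := stage_edge_triangle pF sD s.
have [z Ez] : exists z, f z = z'.
  by apply: (rep_vert rep); rewrite stage_edge_sym in xz; apply: stage_edge_alive pF xz.
rewrite -Ez in xz yz; rewrite stage_edge_sym in xz.
have [b be bp] := rep_edge rep pF yz; have [c ce cp] := rep_edge rep pF xz.
have bT : b \notin T by rewrite inE bp.
have cT : c \notin T by rewrite inE cp.
pose e1 : edge (delete_edges T) := exist _ e eT.
pose e2 : edge (delete_edges T) := exist _ b bT.
pose e3 : edge (delete_edges T) := exist _ c cT.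
exists [set e1; e2; e3]; last by rewrite !inE eqxx.
exists x, y, z, e1, e2, e3; split=> //.
have neq u v : stage_edge D (part e) (f u) (f v) -> u != v.
  by case/and4P; rewrite (inj_eq (rep_inj rep)).
by rewrite /= !inE negb_or (neq x y) // (neq y z) // eq_sym (neq z x).
Qed.

Variables (u v : V).
Hypotheses (uv : u != v) (tE : centre t = [set u; v]).

Definition step_vert (w : vert (op2 T)) : V :=
  match w with inl w => f w | inr b => if b then u else v end.

Definition step_part (e : edge (op2 T)) : {set V} :=
  match e with inl (inl e) => part (val e) | _ => t end.

Lemma represents_step : represents (t |: D) step_vert step_part.
Proof.
(* The centre of [t] is still absent, because [t] is not in [D]. *)
have fc w : f w \notin centre t.
  by apply: contra tD => wt; apply: (implyP (forall_inP (rep_alive rep w) t tF)).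
have uc b : (if b then u else v) \in centre t by rewrite tE; case: b; rewrite !inE eqxx ?orbT.
have ut b : (if b then u else v) \in t by apply: (subsetP (centre_sub dec t)).
have stage_old p x y : p != t -> stage_edge (t |: D) p x y = stage_edge D p x y.
  by move=> pt; rewrite /stage_edge !inE (negPf pt).
have stage_t x y : stage_edge (t |: D) t x y =
    [&& x != y, x \in t, y \in t & (x \in centre t) || (y \in centre t)].
  by rewrite /stage_edge !inE eqxx.
have inj_b b b' : ((if b then u else v) == (if b' then u else v)) = (b == b').
  by case: b b' => [] []; rewrite ?eqxx ?(negPf uv) // eq_sym (negPf uv).
split.
- move=> [w|b] [w'|b'] //= E.
  + by rewrite (rep_inj rep E).
  + by have := fc w; rewrite E uc.
  + by have := fc w'; rewrite -E uc.
  + by move/eqP: E; rewrite inj_b => /eqP ->.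
- move=> [w|b] /=; apply/forall_inP => p pF; apply/implyP => xp; rewrite !inE.
    by rewrite (implyP (forall_inP (rep_alive rep w) p pF) xp) orbT.
  by rewrite (centre_part dec pF tF xp (ut b)) eqxx.
- move=> x xa; have [xt|xt] := boolP (x \in centre t).
    move: xt; rewrite tE !inE => /orP[] /eqP ->; [by exists (inr true) | by exists (inr false)].
  have [|w Ew] := @rep_vert _ _ _ _ rep x; last by exists (inl w).
  apply/forall_inP => p pF; apply/implyP => xp.
  have := implyP (forall_inP xa p pF) xp; rewrite !inE => /orP[/eqP E|//].
  by rewrite -E xp in xt.
- by case=> [[[e eT]|//]|//]; apply: (rep_part rep).
- move=> [[[e eT]|[b [x xT]]]|[]] /=.
  + have [x [y [ee s]]] := rep_ends rep e.
    exists (inl x), (inl y); rewrite ee imsetU1 imset_set1; split=> //=.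
    by rewrite stage_old //; rewrite inE in eT.
  + exists (inr b), (inl x); split=> //=; rewrite stage_t ut uc.
    rewrite in_corners_out inE in xT; case/andP: xT => xc ->; rewrite /= andbT.
    by apply: contraNneq xc => <-.
  + by exists (inr true), (inr false); split=> //=; rewrite stage_t uv (ut true) (ut false) (uc true).
- have old_new e : e \notin T -> part e <> t by rewrite inE => /eqP.
  move=> [[[e eT]|[b [x xT]]]|[]] [[[e' eT']|[b' [x' xT']]]|[]] //= E P.
  + have E' := imset_inj (fun _ _ => @inl_inj _ _ _ _) E.
    have ee := rep_edge_inj rep E' P; subst e'.
    by rewrite (bool_irrelevance eT eT').
  + by case: (old_new e eT).
  + by case: (old_new e eT).
  + by case: (old_new e' eT').
  + have : inr b \in [set inr b'; inl x'] by rewrite -E !inE eqxx.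
    have : inl x \in [set inr b'; inl x'] by rewrite -E !inE eqxx orbT.
    rewrite !inE /= => /eqP[Ex] /orP[/eqP[Eb]|//].
    by move: xT' {E P}; rewrite -Eb -Ex => xT'; rewrite (bool_irrelevance xT xT').
  + have : inl x \in [set inr true; inr false] by rewrite -E !inE eqxx orbT.
    by rewrite !inE.
  + by case: (old_new e' eT').
  + have : inl x' \in [set inr true; inr false] by rewrite E !inE eqxx orbT.
    by rewrite !inE.
move=> p X Y pF; have [->|pt] := eqVneq p t.
  rewrite stage_t; case: X Y => [w|b] [w'|b'] /= /and4P[xy xt yt].
  - by rewrite (negPf (fc w)) (negPf (fc w')).
  - have wc : w \in corners T by rewrite in_corners_out inE fc.
    by exists (inl (inr (b', exist _ w wc))); rewrite // setUC.
  - have wc : w' \in corners T by rewrite in_corners_out inE fc.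
    by exists (inl (inr (b, exist _ w' wc))).
  - move=> _; rewrite inj_b in xy; exists (inr tt) => //=.
    by case: b b' xy {xt yt} => [] [] // _; rewrite setUC.
rewrite stage_old // => s.
(* By [centre_part] the new vertices lie in no part other than [t], so edges of [p] join old
   vertices. *)
have no_new b : (if b then u else v) \notin p.
  by apply: contra pt => bp; rewrite (centre_part dec tF pF (uc b) bp).
case: X Y s => [w|b] [w'|b'] /= s; try by case/and4P: s => _; rewrite ?(negPf (no_new _)).
have [e ee ep] := rep_edge rep pF s.
have eT : e \notin T by rewrite inE ep.
by exists (inl (inl (exist _ e eT))) => //=; rewrite ee imsetU1 imset_set1.
Qed.

End Step.

(** Induction on the list of parts to be replaced; as the list has no repetition, the triangle of
    the next part is still intact. *)
Lemma represents_reachable (s : seq {set V}) : uniq s ->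
  {subset s <= [pred p in F | centre p != set0]} ->
  exists (H : mgraph) (f : vert H -> V) (part : edge H -> {set V}),
    op2_reachable (line_mgraph part_mgraph) H /\ represents [set p in s] f part.
Proof.
elim: s => [|t s IH] /= => [_ _|/andP[ts us] sF].
  exists (line_mgraph part_mgraph), val, (fun e => val (val e).2).
  split; first exact: op2_refl.
  have -> : [set p : {set V} in [::]] = set0 by apply/setP => p; rewrite !inE.
  exact: represents_line.
have sF' : {subset s <= [pred p in F | centre p != set0]}.
  by move=> p ps; apply: sF; rewrite inE ps orbT.
have [H [f [part [reach rep]]]] := IH us sF'.
have /andP[tF t0] : t \in [pred p in F | centre p != set0] by apply: sF; rewrite inE eqxx.
have [c0|/eqP/cards2P[u [v [uv tE]]]] := card_centre dec tF; first by rewrite c0 eqxx in t0.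
have sD : [set p in s] \subset [set p | centre p != set0].
  by apply/subsetP => p; rewrite !inE => /sF' /andP[].
have tD : t \notin [set p in s] by rewrite inE.
have -> : [set p in t :: s] = t |: [set p in s] by apply/setP => p; rewrite !inE.
exists (op2 [set e | part e == t]), (@step_vert H f part t u v), (@step_part H part t).
split; first by apply: op2_step reach _; apply: (eligible_out rep sD tF tD).
exact: represents_step.
Qed.

End Decomposition.

(** * Simple multigraphs and their adjacency relations *)

Section SimpleGraph.

Variable G : mgraph.
Hypothesis simpleG : simple_graph G.
Local Notation r := (@adjacent G).

Lemma adjacentP (x y : vert G) : reflect (exists e : edge G, ends e = [set x; y]) (r x y).
Proof. by apply: (iffP existsP) => -[e /eqP]; exists e => //; apply/eqP. Qed.

Lemma adjacent_sym : symmetric r.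
Proof. by move=> x y; rewrite /adjacent setUC. Qed.

Lemma adjacent_irr : irreflexive r.
Proof.
move=> x; apply/negbTE/negP => /adjacentP[e E].
by have := card_ends e; rewrite E cards2 eqxx.
Qed.

(** Neighbours of [x] and edges at [x] both correspond bijectively to the same 2-sets containing
    [x], the edges by simplicity. *)
Lemma card_adjacent x : #|[set y | r x y]| = degree x.
Proof.
rewrite /degree -(card_imset _ simpleG).
have inj : {in [set y | r x y] &, injective (fun y => [set x; y])}.
  move=> y z; rewrite !inE => xy _ E.
  have : y \in [set x; z] by rewrite -E !inE eqxx orbT.
  rewrite !inE => /orP[] /eqP // Ey.
  by rewrite Ey adjacent_irr in xy.
rewrite -(card_in_imset inj); apply: eq_card => A.
apply/imsetP/imsetP => [[y]|[e]]; rewrite inE.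
  by case/adjacentP => e E ->; exists e; rewrite ?inE E ?inE ?eqxx.
have [a [b [ab E]]] := endsP e; rewrite E !inE => /orP[] /eqP -> ->.
  by exists b; rewrite ?E // inE; apply/adjacentP; exists e.
by exists a; rewrite ?E 1?setUC // inE; apply/adjacentP; exists e; rewrite E setUC.
Qed.

Lemma adjacent_triangle : triangle_property G ->
  forall x y, r x y -> exists2 z, r x z & r y z.
Proof.
move=> tri x y xy; have /adjacentP[e E] := xy.
have [T [a [b [c [e1 [e2 [e3 [us [E1 E2 E3] ->]]]]]]] eT] := tri e.
have ab : r a b by apply/adjacentP; exists e1.
have bc : r b c by apply/adjacentP; exists e2.
have ca : r c a by apply/adjacentP; exists e3.
have third u v w : ends e = [set u; v] -> r u w -> r v w -> exists2 z, r x z & r y z.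
  rewrite E => Exy uw vw.
  have [xuv yuv] : x \in [set u; v] /\ y \in [set u; v].
    by rewrite -Exy !inE !eqxx orbT.
  by exists w; [move: xuv | move: yuv]; rewrite !inE => /orP[] /eqP ->.
move: eT; rewrite !inE => /orP[/orP[]|] /eqP Ee; rewrite Ee in third.
- by apply: (third _ _ c E1); rewrite // adjacent_sym.
- by apply: (third _ _ a E2); rewrite // adjacent_sym.
- by apply: (third _ _ b E3); rewrite // adjacent_sym.
Qed.

End SimpleGraph.

(** * Recognising the graph in each of the two outcomes *)

Lemma isomorphic_adjacent (G H : mgraph) (f : vert G -> vert H) :
  simple_graph G -> simple_graph H -> bijective f ->
  (forall x y, adjacent (f x) (f y) = adjacent x y) -> isomorphic G H.
Proof.
move=> sG sH bf adj.
have ex e : exists h : edge H, ends h == f @: ends e.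
  have [x [y [_ E]]] := endsP e.
  have /adjacentP[h Eh] : adjacent (f x) (f y) by rewrite adj; apply/adjacentP; exists e.
  by exists h; rewrite Eh E imsetU1 imset_set1.
have gE e : ends (xchoose (ex e)) = f @: ends e by apply/eqP/(xchooseP (ex e)).
exists f, (fun e => xchoose (ex e)); split=> //; apply: inj_surj_bij => [e e' E|h].
  apply/sG/(imset_inj (bij_inj bf)); by rewrite -!gE E.
have [x' [y' [_ E]]] := endsP h; case: (bf) => f' fK f'K.
have /adjacentP[e Ee] : adjacent (f' x') (f' y').
  by rewrite -adj !f'K; apply/adjacentP; exists h.
by exists e; apply: sH; rewrite gE Ee E imsetU1 imset_set1 !f'K.
Qed.

(** Once every part with a centre has been replaced, stage edges are part edges. Hence [H] has the
    adjacency of [G], and [part_unique] rules out parallel edges. *)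
Lemma isomorphic_line (G : mgraph) (F : {set {set vert G}}) (centre : {set vert G} -> {set vert G}) :
  simple_graph G -> regular 4 G -> decomposition (@adjacent G) F centre ->
  exists M H : mgraph, [/\ regular 3 M, op2_reachable (line_mgraph M) H, simple_graph H
      & isomorphic G H].
Proof.
move=> sG reg dec.
have deg4 (x : vert G) : #|[set y | adjacent x y]| = 4 by rewrite card_adjacent // reg.
pose D := [set p in enum [pred p in F | centre p != set0]].
have [|H [f [part [reach rep]]]] := represents_reachable dec deg4 (enum_uniq [pred p in F | centre p != set0]).
  by move=> p; rewrite mem_enum.
have aliveD x : alive F centre D x.
  apply/forall_inP => p pF; apply/implyP => xp; rewrite inE mem_enum inE pF.
  by apply: contraTneq xp => ->; rewrite inE.
have bf : bijective f.
  by apply: inj_surj_bij => [|x]; [apply: rep_inj rep | apply: (rep_vert rep)].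
have stageE p x y : p \in F -> stage_edge centre D p x y = part_edge centre p x y.
  move=> pF; rewrite /stage_edge /part_edge inE mem_enum inE pF.
  have [-> | _] //= := eqVneq (centre p) set0.
  by rewrite !inE.
have adj x y : adjacent (f x) (f y) = adjacent x y.
  apply/idP/adjacentP => [/(part_exists dec)[p pF]|[e]].
    by rewrite -stageE // => /(rep_edge rep pF)[e Ee _]; exists e.
  have [u [v [-> ]]] := rep_ends rep e.
  rewrite stageE ?(rep_part rep) // => /(part_adj dec (rep_part rep e)) uv E.
  move: uv; rewrite /adjacent; suff -> : [set f u; f v] = [set f x; f y] by [].
  by have := congr1 (fun A : {set vert H} => f @: A) E; rewrite !imsetU1 !imset_set1.
have sH : simple_graph H.
  move=> e e' Ee; apply: (rep_edge_inj rep) => //; move: Ee.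
  have [x [y [E s]]] := rep_ends rep e; have [x' [y' [E' s']]] := rep_ends rep e'.
  move: s s'; rewrite !stageE ?(rep_part rep) // => s s' Ee.
  apply: (part_unique dec (rep_part rep e) (rep_part rep e') s).
  have x_y : f x != f y by case/and4P: s.
  have xE : x \in [set x'; y'] by rewrite -E' -Ee E !inE eqxx.
  have yE : y \in [set x'; y'] by rewrite -E' -Ee E !inE eqxx orbT.
  move: xE yE x_y; rewrite !inE => /orP[] /eqP -> /orP[] /eqP ->; rewrite ?eqxx // => _.
  by rewrite part_edge_sym.
exists (part_mgraph dec deg4), H; split=> //; first exact: part_mgraph_cubic.
by apply/isomorphic_sym/(isomorphic_adjacent sH sG bf adj).
Qed.

Lemma rel_edge2 (V : finType) (r : rel V) x y :
  rel_edge r [set x; y] = [&& x != y, r x y & r y x].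
Proof.
rewrite /rel_edge cards2; have [<-|xy] //= := eqVneq x y.
apply/forall_inP/andP => [H|[xy' yx'] a].
  have /forall_inP Hx := H x (set21 x y); have /forall_inP Hy := H y (set22 x y).
  split; [apply: (implyP (Hx y (set22 x y))) => // | apply: (implyP (Hy x (set21 x y)))].
  by rewrite eq_sym.
by rewrite !inE => /orP[] /eqP ->; apply/forall_inP => b; rewrite !inE => /orP[] /eqP ->;
  rewrite ?eqxx //; apply/implyP.
Qed.

Lemma adjacent_graph_of_rel (V : finType) (r : rel V) (x y : V) :
  @adjacent (graph_of_rel r) x y = [&& x != y, r x y & r y x].
Proof.
rewrite -rel_edge2; apply/adjacentP/idP => [[e <-]|xy]; first exact: valP.
by exists (Sub _ xy).
Qed.

(** The four cyclic neighbours exhaust degree 4, so the image of the sequence is closed under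
    adjacency, and connectedness makes it the whole graph. *)
Lemma isomorphic_square_cycle (G : mgraph) n (v : nat -> vert G) :
  simple_graph G -> regular 4 G -> connected_graph G ->
  square_cyclic (@adjacent G) n v -> isomorphic G (squared_cycle n).
Proof.
(* Writing [n] as a double successor lets ['Z_n] reduce to the ordinals below [n]. *)
case: n => [|[|n]] sG reg conn [n5 inj adj] //.
pose Z := 'Z_(n.+2).
have inj_f : injective (fun i : Z => v i).
  by move=> i j E; apply/val_inj/inj => //; apply: ltn_ord.
have add1 (i : Z) : nat_of_ord (i + 1)%R = i.+1 %% n.+2.
  by rewrite /= modnDmr addn1.
have add2 (i : Z) : nat_of_ord (i + 2)%R = i.+2 %% n.+2.
  by rewrite -[2%R]/(1 + 1)%R GRing.addrA !add1 -addn1 modnDml addn1.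
have fadj1 (i : Z) : adjacent (v i) (v (i + 1)%R).
  by rewrite add1; case: (adj i (ltn_ord i)).
have fadj2 (i : Z) : adjacent (v i) (v (i + 2)%R).
  by rewrite add2; case: (adj i (ltn_ord i)).
(* The offsets 1, -1, 2, -2 differ pairwise by at most 4, hence remain distinct modulo a number that
   is at least 5. *)
have nz k : 0 < k < 5 -> (k%:R : Z)%R != 0%R.
  case/andP=> k0 k5; rewrite -(inj_eq val_inj) /= val_Zp_nat // modn_small ?(leq_trans k5) //.
  by rewrite -lt0n.
have fadj (i : Z) y : adjacent (v i) y =
    (y \in map (fun i : Z => v i) [:: i + 1; i - 1; i + 2; i - 2]%R).
  move: y; apply: nbr4; rewrite ?fadj1 ?fadj2 //.
  - by move=> x; rewrite card_adjacent // reg.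
  - rewrite -[X in uniq X]/(map (fun i : Z => v i) [:: i + 1; i - 1; i + 2; i - 2]%R).
    rewrite (map_inj_uniq inj_f) /= !inE !negb_or.
    have neq k (a b : Z) : (a - b = k%:R)%R -> 0 < k < 5 -> (a != b) && (b != a).
      by move=> E k5; rewrite [b == a]eq_sym andbb -GRing.subr_eq0 E nz.
    have /andP[-> _] := @neq 2 (i + 1)%R (i - 1)%R ltac:(ring) isT.
    have /andP[_ ->] := @neq 1 (i + 2)%R (i + 1)%R ltac:(ring) isT.
    have /andP[-> _] := @neq 3 (i + 1)%R (i - 2)%R ltac:(ring) isT.
    have /andP[_ ->] := @neq 3 (i + 2)%R (i - 1)%R ltac:(ring) isT.
    have /andP[-> _] := @neq 1 (i - 1)%R (i - 2)%R ltac:(ring) isT.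
    by have /andP[-> _] := @neq 4 (i + 2)%R (i - 2)%R ltac:(ring) isT.
  - by rewrite adjacent_sym -{2}[i](GRing.subrK 1%R) fadj1.
  - by rewrite adjacent_sym -{2}[i](GRing.subrK 2%R) fadj2.
have bf : bijective (fun i : Z => v i).
  apply: inj_surj_bij => // y.
  have cl : closed (@adjacent G) [pred x | [exists i : Z, v i == x]].
    apply: intro_closed; first exact/sym_connect_sym/adjacent_sym.
    move=> x z xz; rewrite !inE => /existsP[i /eqP Ex].
    by move: xz; rewrite -Ex fadj => /mapP[j _ ->]; apply/existsP; exists j.
  have := closed_connect cl (conn (v (0%R : Z)) y); rewrite !inE => E.
  have : [exists i : Z, v i == y] by rewrite -E; apply/existsP; exists 0%R.
  by case/existsP => i /eqP; exists i.
have sC : simple_graph (squared_cycle n.+2) by move=> e e' /val_inj.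
apply/isomorphic_sym.
apply: (@isomorphic_adjacent (squared_cycle n.+2) G (fun i : Z => v i) sC sG bf) => i j.
rewrite adjacent_graph_of_rel -!(mem_map inj_f) -!fadj (adjacent_sym (v j)) andbb.
by have [->|//] := eqVneq i j; rewrite adjacent_irr.
Qed.

Theorem corollary1 (G : mgraph) :
  simple_graph G -> connected_graph G -> regular 4 G -> triangle_property G ->
  5 <= #|vert G| ->
  (exists n : nat, 5 <= n /\ isomorphic G (squared_cycle n)) \/
  (exists M H : mgraph,
    [/\ regular 3 M, op2_reachable (line_mgraph M) H, simple_graph H
      & isomorphic G H]).
Proof.
move=> sG conn reg tri _.
(* [square_cyclic] is applied here to functions on [nat], so the case distinction is made
   classically. *)
case: (classic (exists n v, square_cyclic (@adjacent G) n v)) => [[n [v sq]]|none].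
  left; exists n; split; first by case: sq.
  exact: isomorphic_square_cycle sq.
have deg4 (x : vert G) : #|[set y | adjacent x y]| = 4 by rewrite card_adjacent // reg.
right; apply: (isomorphic_line sG reg).
apply: quartic_decomposition (@adjacent_sym G) (@adjacent_irr G) deg4 _ _.
  exact: adjacent_triangle.
by move=> n v sq; apply: none; exists n, v.
Qed.
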